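(* Let $\Bbbk$ be a field of characteristic zero. For every degree $n\ge 1$, the variety of (nonassociative) $\Bbbk$-algebras with one bilinear product satisfying the right nil identity of degree $n$, $$x(x(\cdots(xx^2)))=0,$$ has the Nielsen–Schreier property.
   Context: The left-hand side of the identity is the right-normed product of $n$ copies of $x$, that is $r_n(x)$, where $r_1(x)=x$ and $r_{k+1}(x)=x\,r_k(x)$. A variety of algebras has the Nielsen–Schreier property if every subalgebra of every free algebra of the variety is free in that variety. *)

(* Defs.v *)
From HB Require Import structures.
From mathcomp Require Import all_boot all_algebra.
From mathcomp Require Import boolp classical_sets.

Set Implicit Arguments.
Unset Strict Implicit.
Unset Printing Implicit Defensive.

Import GRing.Theory.
Local Open Scope ring_scope.

(* Algebras with one bilinear product: neither associativity, commutativity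
   nor a unit is required. *)
HB.mixin Record Lmodule_isNonAssocAlgebra (K : fieldType) A
    of GRing.Lmodule K A := {
  namul : A -> A -> A;
  namul_bilinear : bilinear_for *:%R *:%R namul
}.

#[short(type="naAlgType")]
HB.structure Definition NonAssocAlgebra (K : fieldType) :=
  {A of Lmodule_isNonAssocAlgebra K A & GRing.Lmodule K A}.

Record subalgebra (K : fieldType) (A : naAlgType K) := Subalgebra {
  subalg_set :> set A;
  subalg_submod : submod_closed [in subalg_set];
  subalg_mul : forall x y, x \in subalg_set -> y \in subalg_set ->
    namul x y \in subalg_set
}.

Section SubalgebraType.
Variables (K : fieldType) (A : naAlgType K) (S : subalgebra A).

Definition subalg_pred : {pred A} := [in subalg_set S].

HB.instance Definition _ :=
  GRing.isSubmodClosed.Build K A subalg_pred (subalg_submod S).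

Definition subalg_type := {x : A | x \in subalg_pred}.

HB.instance Definition _ := Choice.on subalg_type.
HB.instance Definition _ := SubType.on subalg_type.
HB.instance Definition _ := [SubChoice_isSubLmodule of subalg_type by <:].

Definition subalg_namul (x y : subalg_type) : subalg_type :=
  exist _ (namul (val x) (val y)) (subalg_mul (valP x) (valP y)).

Lemma subalg_namul_bilinear : bilinear_for *:%R *:%R subalg_namul.
Proof.
have [Hl Hr] := @namul_bilinear K A.
by split=> [y a u v|x a u v]; apply: val_inj; rewrite !linearP /=;
  [apply: Hl | apply: Hr].
Qed.

HB.instance Definition _ :=
  Lmodule_isNonAssocAlgebra.Build K subalg_type subalg_namul_bilinear.

End SubalgebraType.

(* An algebra homomorphism is a linear map which satisfies [multiplicative]. *)
Definition multiplicative (K : fieldType) (A B : naAlgType K) (phi : A -> B) :=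
  {morph phi : x y / namul x y}.

(* A variety is given by the class [V] of its algebras; [F] is free in [V] on
   the family [iota : X -> F] when it satisfies the universal property. *)
Definition free_on (K : fieldType) (V : naAlgType K -> Prop)
    (F : naAlgType K) (X : Type) (iota : X -> F) : Prop :=
  V F /\
  forall (B : naAlgType K), V B -> forall f : X -> B,
    (exists phi : {linear F -> B},
        multiplicative phi /\ (forall x, phi (iota x) = f x)) /\
    (forall phi psi : {linear F -> B},
        multiplicative phi -> (forall x, phi (iota x) = f x) ->
        multiplicative psi -> (forall x, psi (iota x) = f x) ->
        phi =1 psi).

Definition free_in (K : fieldType) (V : naAlgType K -> Prop)
    (F : naAlgType K) : Prop :=
  exists (X : Type) (iota : X -> F), free_on V iota.

Definition Nielsen_Schreier (K : fieldType) (V : naAlgType K -> Prop) : Prop :=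
  forall F : naAlgType K, free_in V F ->
  forall S : subalgebra F, free_in V (subalg_type S).

(* Right-normed powers, indexed from 1 (index 0 is a junk value):
   [rpow 1 x = x] and [rpow k.+1 x = namul x (rpow k x)] for [0 < k]. *)
Definition rpow (K : fieldType) (A : naAlgType K) (n : nat) (x : A) : A :=
  iter n.-1 (namul x) x.

Definition right_nil (K : fieldType) (n : nat) (A : naAlgType K) : Prop :=
  forall x : A, rpow n x = 0.

(* Main.v *)
From HB Require Import structures.
From mathcomp Require Import all_boot all_algebra.
From mathcomp Require Import zify.
From mathcomp Require Import boolp classical_sets functions.

Set Implicit Arguments.
Unset Strict Implicit.
Unset Printing Implicit Defensive.

Import GRing.Theory.
Require Import Defs.
Local Open Scope ring_scope.

(** Let [F] be free in the variety. Its multiplication is as injective as the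
    identity allows: the kernel of [F (x) F -> F] is spanned by the tensors
    [a (x) rpow n.-1 a] ([free_kernel]). The reason is that a bilinear map which
    vanishes on these pairs defines an extension of [F] by a null ideal that stays
    in the variety, and that a splitting of this extension expresses the bilinear
    map as a linear function of the product. So the kernel is the image of the
    [n]-th symmetric power of [F].

    The key point is that the map of symmetric powers [a ^ (n-1) |-> rpow n.-1 a]
    is injective ([sym_power_injective]); even all exponents from [2] to [n - 1]
    together are independent ([sym_powers_independent]). This follows from the
    description of the kernel by induction on the degree, through a comparison of
    the largest degrees of factors. Consequently, a relation among products of
    elements of a graded subspace [H] involves only the symmetric power of [H]
    ([kernel_in_submodule]): its derivative along any functional that vanishes on
    [H] is zero. A graded subalgebra [H] thus inherits the property that its
    multiplication has no relations besides the identity, and such an algebra is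
    free on any homogeneous basis of a complement of its decomposable elements.

    A general subalgebra [S] is compared with the algebra [H] of its leading
    terms. Choose homogeneous free generators of [H] and elements of [S] with
    these leading terms. The algebra [G] that is free on the same set maps to [H]
    by [psi] and to [S] by [phi], and [psi] is the leading part of [phi]; as [psi]
    is injective, so is [phi], and [phi] is onto [S] by descent on the degree.

    Gradings are obtained from the automorphisms that rescale generators, since a
    field of characteristic zero has enough scalars to separate degrees
    ([free_grading]). Tensors, symmetric or not, are lists, and are compared
    through their values on functionals. *)

(** * Bases of vector spaces modulo a subspace *)

Section LinearAlgebra.
Variable K : fieldType.
Implicit Types V W Z : lmodType K.

Definition submodule V (U : V -> Prop) :=
  U 0 /\ forall a x y, U x -> U y -> U (a *: x + y).

Lemma submoduleD V (U : V -> Prop) x y : submodule U -> U x -> U y -> U (x + y).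
Proof. by move=> [_ hU] Ux Uy; rewrite -[x]scale1r; apply: hU. Qed.

Lemma submoduleZ V (U : V -> Prop) a x : submodule U -> U x -> U (a *: x).
Proof. by move=> [U0 hU] Ux; rewrite -[_ *: _]addr0; apply: hU. Qed.

Lemma submoduleB V (U : V -> Prop) x y : submodule U -> U x -> U y -> U (x - y).
Proof.
by move=> hU Ux Uy; rewrite addrC -scaleN1r; apply: (proj2 hU).
Qed.

Lemma submodule_sum V (U : V -> Prop) (I : eqType) (r : seq I) (F : I -> V) :
  submodule U -> (forall i, i \in r -> U (F i)) -> U (\sum_(i <- r) F i).
Proof.
move=> hU hF; rewrite big_seq; apply: big_ind => //; first exact: (proj1 hU).
by move=> x y; apply: submoduleD.
Qed.

Definition mklin V W (f : V -> W) (hf : linear f) : {linear V -> W} :=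
  HB.pack f (GRing.isLinear.Build K V W *:%R f hf).

Lemma image_submodule V W (f : {linear V -> W}) :
  submodule (fun y => exists x, y = f x).
Proof.
split; first by exists 0; rewrite linear0.
by move=> a _ _ [x ->] [y ->]; exists (a *: x + y); rewrite linearP.
Qed.

(** Collecting equal vectors shows that a formal combination whose coefficients
    all cancel, which scalar functions [g] suffice to detect, is mapped to zero
    by every function into every vector space. *)
Lemma formal_comb_eq0 V (l : seq (K * V)) :
  (forall g : V -> K, \sum_(p <- l) p.1 * g p.2 = 0) ->
  forall W (h : V -> W), \sum_(p <- l) p.1 *: h p.2 = 0.
Proof.
move=> hl W h; pose s := undup [seq p.2 | p <- l].
have -> : \sum_(p <- l) p.1 *: h p.2 =
    \sum_(p <- l) \sum_(y <- s) (p.1 * (y == p.2)%:R) *: h y.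
  rewrite big_seq [RHS]big_seq; apply: eq_bigr => p pl.
  have ps : p.2 \in s by rewrite mem_undup map_f.
  rewrite (bigD1_seq p.2) ?undup_uniq //= eqxx mulr1 big1 ?addr0 // => y.
  by move/negbTE=> ->; rewrite mulr0 scale0r.
rewrite exchange_big /= big1 // => y _.
by rewrite -scaler_suml (hl (fun z => (y == z)%:R)) scale0r.
Qed.

(** Linear independence modulo [D], in a form where the vectors of [l] may
    repeat: the function [g] reads off the total coefficient of each vector.
    This form is finitary, so it passes to unions of chains. *)
Definition independent V (D Y : V -> Prop) :=
  forall l : seq (K * V), (forall p, p \in l -> Y p.2) ->
    D (\sum_(p <- l) p.1 *: p.2) ->
  forall g : V -> K, \sum_(p <- l) p.1 * g p.2 = 0.

Definition span_mod V (D Y : V -> Prop) (x : V) :=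
  exists2 l : seq (K * V), forall p, p \in l -> Y p.2 &
    D (x - \sum_(p <- l) p.1 *: p.2).

Lemma independent_extend V (D Y : V -> Prop) h :
  submodule D -> independent D Y -> ~ span_mod D Y h ->
  independent D (fun x => Y x \/ x = h).
Proof.
move=> hD iY nh l hl Dl g; pose c := \sum_(p <- l | p.2 == h) p.1.
pose l0 := [seq p <- l | p.2 != h].
have hl0 p : p \in l0 -> Y p.2.
  by rewrite mem_filter => /andP[/eqP ph /hl[]].
have eqD : \sum_(p <- l) p.1 *: p.2 = c *: h + \sum_(p <- l0) p.1 *: p.2.
  rewrite (bigID (fun p => p.2 == h)) /= big_filter; congr (_ + _).
  by rewrite scaler_suml; apply: eq_bigr => p /eqP ->.
have [c0|c0] := eqVneq c 0.
  rewrite (bigID (fun p => p.2 == h)) /= -[X in _ + X]big_filter -/l0.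
  rewrite (iY l0 hl0) ?addr0; last by move: Dl; rewrite eqD c0 scale0r add0r.
  rewrite (eq_bigr (fun p => p.1 * g h)); last by move=> p /eqP ->.
  by rewrite -mulr_suml -/c c0 mul0r.
case: nh; exists [seq (- c^-1 * p.1, p.2) | p <- l0].
  by move=> _ /mapP[p pl ->] /=; apply: hl0.
rewrite big_map /=.
have -> : h - \sum_(p <- l0) (- c^-1 * p.1) *: p.2 =
   c^-1 *: \sum_(p <- l) p.1 *: p.2.
  rewrite eqD scalerDr scalerA mulVf // scale1r; congr (_ + _).
  rewrite scaler_sumr -sumrN; apply: eq_bigr => p _.
  by rewrite mulNr scaleNr opprK scalerA.
exact: submoduleZ.
Qed.

(** Zorn's lemma. The given set [Y] is kept so that a basis of [H] modulo [D]
    can afterwards be completed to a basis of the whole space. *)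
Lemma maximal_independent V (D Y H : V -> Prop) :
  submodule D -> independent D Y ->
  exists A : V -> Prop, [/\ forall x, A x -> H x,
    independent D (fun x => Y x \/ A x) &
    forall h, H h -> span_mod D (fun x => Y x \/ A x) h].
Proof.
move=> hD iY.
pose P (A : set V) := (forall x, A x -> H x) /\
  independent D (fun x => Y x \/ A x).
have [|A [[AH iA] maxA]] := @Zorn_bigcup V P.
  move=> F FP Ftot; split; first by move=> x [X FX Xx]; apply: (FP X FX).1.
  move=> l hl.
  have [hY|[X FX hX]] : (forall p, p \in l -> Y p.2) \/
      exists2 X, F X & forall p, p \in l -> Y p.2 \/ X p.2.
    elim: l hl => [|p l IH] hl; first by left.
    have [|hY|[X FX hX]] := IH.
    - by move=> q ql; apply: hl; rewrite in_cons ql orbT.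
    - have [hp|[X FX Xp]] := hl p (mem_head _ _).
        by left=> q; rewrite in_cons => /predU1P[->//|/hY].
      by right; exists X => // q; rewrite in_cons
        => /predU1P[->|/hY]; [right|left].
    - have [hp|[X' FX' Xp]] := hl p (mem_head _ _).
        by right; exists X => // q; rewrite in_cons
          => /predU1P[->|/hX]; [left|].
      have [XX|XX] := Ftot _ _ FX FX'.
        right; exists X' => // q; rewrite in_cons.
        by case/predU1P=> [->|/hX[|/XX]]; [right|left|right].
      right; exists X => // q; rewrite in_cons.
      by case/predU1P=> [->|/hX//]; right; apply: XX.
    by apply: iY.
  by apply: (FP X FX).2.
exists A; split=> // h Hh; apply: contrapT => nh.
apply: (maxA (fun x => A x \/ x = h)); first split.
- by move=> x; left.
- move=> sub; apply: nh; exists [:: (1, h)].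
    by move=> p; rewrite inE => /eqP -> /=; right; apply: sub; right.
  by rewrite big_seq1 /= scale1r subrr; apply: (proj1 hD).
- split; first by move=> x [/AH//|->].
  have := independent_extend hD iA nh.
  move=> iA' l hl; apply: iA' => p /hl.
  by case=> [?|[?|?]]; [left; left|left; right|right].
Qed.

(** A basis [Y] of [H] modulo [D], described by what it is used for: an
    induction principle for [H], and the extension of arbitrary functions on
    [Y] to linear maps on all of [V] that vanish on [D]. *)
Theorem relative_basis V (D H : V -> Prop) : submodule D ->
  exists Y : V -> Prop,
  [/\ forall y, Y y -> H y,
      forall U : V -> Prop, submodule U -> (forall x, D x -> U x) ->
        (forall x, Y x -> U x) -> forall x, H x -> U x &
      forall W (g : V -> W), exists2 f : {linear V -> W},
        forall x, D x -> f x = 0 & forall y, Y y -> f y = g y].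
Proof.
move=> hD.
have i0 : independent D (fun=> False).
  by move=> [|p l] hl _ g; [rewrite big_nil|case: (hl p (mem_head _ _))].
have [Y [YH iY' spY]] := maximal_independent H hD i0.
have iY : independent D Y.
  by move=> l hl; apply: iY' => p /hl; right.
exists Y; split=> // [U hU DU YU x /spY[l hl Dl]|W g].
  rewrite -[x](subrK (\sum_(p <- l) p.1 *: p.2)).
  apply: submoduleD => //; first exact: DU.
  apply: submodule_sum => // p /hl[//|Yp]; apply: submoduleZ => //.
  exact: YU.
have [A [_ iA spA]] := maximal_independent (fun=> True) hD iY.
have /choice[sel selP] : forall x, exists l : seq (K * V),
    (forall p, p \in l -> Y p.2 \/ A p.2) /\ D (x - \sum_(p <- l) p.1 *: p.2).
  by move=> x; have [l] := spA x I; exists l.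
(* Two expansions of the same vector differ by a formal combination which
     vanishes modulo [D]; by independence its value under [g] is zero, so the
     choice of expansions defines a linear map. *)
have wd c x y (l l1 l2 : seq (K * V)) :
    (forall p, p \in l -> Y p.2 \/ A p.2) ->
    (forall p, p \in l1 -> Y p.2 \/ A p.2) ->
    (forall p, p \in l2 -> Y p.2 \/ A p.2) ->
    D (c *: x + y - \sum_(p <- l) p.1 *: p.2) ->
    D (x - \sum_(p <- l1) p.1 *: p.2) -> D (y - \sum_(p <- l2) p.1 *: p.2) ->
    \sum_(p <- l) p.1 *: g p.2 =
      c *: (\sum_(p <- l1) p.1 *: g p.2) + \sum_(p <- l2) p.1 *: g p.2.
  move=> hl hl1 hl2 dl dl1 dl2; apply/eqP; rewrite -subr_eq0; apply/eqP.
  pose L := l ++ [seq (- c * p.1, p.2) | p <- l1] ++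
    [seq (- 1 * p.1, p.2) | p <- l2].
  have hL (Z : lmodType K) (h : V -> Z) : \sum_(p <- L) p.1 *: h p.2 =
    \sum_(p <- l) p.1 *: h p.2 -
    (c *: (\sum_(p <- l1) p.1 *: h p.2) + \sum_(p <- l2) p.1 *: h p.2).
    rewrite !big_cat /= !big_map /= opprD scaler_sumr -!sumrN.
    congr (_ + (_ + _)); apply: eq_bigr => p _.
      by rewrite mulNr scaleNr scalerA.
    by rewrite mulN1r scaleNr.
  rewrite -hL; apply: formal_comb_eq0; apply: iA.
    move=> p; rewrite !mem_cat => /or3P[/hl//|/mapP[q ql ->]|/mapP[q ql ->]].
      exact: (hl1 q ql).
    exact: (hl2 q ql).
  rewrite (hL V id) /=.
  set a := \sum_(p <- l) _ in dl *; set b := \sum_(p <- l1) _ in dl1 *.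
  set d := \sum_(p <- l2) _ in dl2 *.
  have -> : a - (c *: b + d) =
      (c *: (x - b) + (y - d)) - (c *: x + y - a).
    by rewrite scalerBr addrACA -opprD opprB [RHS]addrC addrA subrK.
  by apply: submoduleB => //; apply: (proj2 hD).
pose f x := \sum_(p <- sel x) p.1 *: g p.2.
have linf : linear f.
  move=> c x y; have [? ?] := selP (c *: x + y).
  have [? ?] := selP x; have [? ?] := selP y.
  exact: (wd c x y).
have val x l : (forall p, p \in l -> Y p.2 \/ A p.2) ->
    D (x - \sum_(p <- l) p.1 *: p.2) -> f x = \sum_(p <- l) p.1 *: g p.2.
  move=> hl dl; have [? ?] := selP x.
  have := wd 0 0 x (sel x) [::] l.
  rewrite !big_nil !scaler0 !add0r oppr0; apply=> //.
  exact: (proj1 hD).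
exists (mklin linf) => [x Dx|y Yy] /=.
  by rewrite (val x [::]) ?big_nil ?subr0.
rewrite (val y [:: (1, y)]) ?big_seq1 /= ?scale1r //.
  by move=> p; rewrite inE => /eqP ->; left.
by rewrite subrr; apply: (proj1 hD).
Qed.

Lemma zero_submodule V : submodule (fun x : V => x = 0).
Proof. by split=> // a x y -> ->; rewrite scaler0 addr0. Qed.

Lemma separation V (U : V -> Prop) v : submodule U -> ~ U v ->
  exists2 f : {linear V -> K^o}, forall x, U x -> f x = 0 & f v = 1.
Proof.
move=> hU nUv.
have [Y [Yv spY extY]] := relative_basis (fun x => exists c, x = c *: v) hU.
have /choice[g gP] : forall y, exists c, Y y -> y = c *: v.
  move=> y; have [/Yv[c ->]|nY] := pselect (Y y); first by exists c.
  by exists 0 => /nY.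
have [f fU fY] := extY K^o g; exists f => //.
have : U (v - f v *: v).
  apply: (spY (fun x => U (x - f x *: v))) => //.
  - split; first by rewrite linear0 scale0r subr0; apply: (proj1 hU).
    move=> a x y Ux Uy; rewrite linearP scalerDl opprD addrACA /=.
    by rewrite -scalerA -scalerBr; apply: (proj2 hU).
  - by move=> x Ux; rewrite fU // scale0r subr0.
  - by move=> y Yy; rewrite fY // -gP // subrr; apply: (proj1 hU).
  - by exists 1; rewrite scale1r.
rewrite -[X in X - _]scale1r -scalerBl => Uv; apply/eqP; rewrite eq_sym -subr_eq0.
apply/negPn/negP => ne0; apply: nUv.
by rewrite -[v]scale1r -(mulVf ne0) -scalerA; apply: submoduleZ.
Qed.

Lemma separates0 V (v : V) : (forall f : {linear V -> K^o}, f v = 0) -> v = 0.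
Proof.
move=> hv; apply: contrapT => v0.
have [f _] := separation (zero_submodule V) v0.
by rewrite hv => /eqP; rewrite eq_sym oner_eq0.
Qed.

(** The quotient of [V] by [U] is realized inside [V], by a map [q] with
    kernel [U]; then [x - q x] is a projection onto [U]. *)
Lemma quotient_section V (U : V -> Prop) : submodule U ->
  exists2 q : {linear V -> V}, forall x, U x -> q x = 0 & forall x, U (x - q x).
Proof.
move=> hU; have [Y [_ spY extY]] := relative_basis (fun=> True) hU.
have [q qU qY] := extY V id; exists q => // x.
apply: (spY (fun x => U (x - q x))) => //.
- split; first by rewrite linear0 subr0; apply: (proj1 hU).
  move=> a y z Uy Uz; rewrite linearP opprD addrACA -scalerBr.
  exact: (proj2 hU).
- by move=> y Uy; rewrite qU // subr0.
- by move=> y Yy; rewrite qY // subrr; apply: (proj1 hU).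
Qed.

Lemma generalized_inverse V W (f : {linear V -> W}) :
  exists g : {linear W -> V}, forall x, f (g (f x)) = f x.
Proof.
have [Y [imY spY extY]] :=
  relative_basis (fun y => exists x, y = f x) (zero_submodule W).
have /choice[h hP] : forall y, exists x, Y y -> y = f x.
  move=> y; have [/imY[x ->]|nY] := pselect (Y y); first by exists x.
  by exists 0 => /nY.
have [g _ gY] := extY V h; exists g => x.
apply: (spY (fun y => f (g y) = y)) => //; last by exists x.
- by split=> [|a y z yE zE]; rewrite ?linear0 // !linearP yE zE.
- by move=> y ->; rewrite !linear0.
- by move=> y Yy; rewrite gY // -hP.
Qed.

(** * Tensors as lists of pairs *)

Definition bilin V W Z (b : V -> W -> Z) :=
  (forall w, linear (fun v => b v w)) /\ (forall v, linear (b v)).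

Fixpoint in_span V (s : seq V) (x : V) : Prop :=
  if s is v :: s' then exists c, in_span s' (x - c *: v) else x = 0.

Lemma in_span_submodule V (s : seq V) : submodule (in_span s).
Proof.
elim: s => [|v s [IH0 IH]] /=; first exact: zero_submodule.
split; first by exists 0; rewrite scale0r subr0.
move=> a x y [c xs] [d ys]; exists (a * c + d).
rewrite scalerDl opprD addrACA -scalerA -scalerBr; exact: IH.
Qed.

Lemma in_span_mem V (s : seq V) x : x \in s -> in_span s x.
Proof.
elim: s => //= v s IH; rewrite in_cons => /predU1P[->|/IH xs].
  by exists 1; rewrite scale1r subrr; apply: (proj1 (in_span_submodule s)).
by exists 0; rewrite scale0r subr0.
Qed.

(** In a tensor, a first factor that depends linearly on the others can be
    moved into the second factors. The conclusion quantifies over all bilinear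
    maps, so it speaks of the tensors themselves. *)
Lemma tensor_absorb V W (l : seq (V * W)) u v :
  in_span [seq p.1 | p <- l] u ->
  exists2 l' : seq (V * W), size l' = size l &
    forall Z (b : V -> W -> Z), bilin b ->
      b u v + \sum_(p <- l) b p.1 p.2 = \sum_(p <- l') b p.1 p.2.
Proof.
elim: l u => [|p l IH] u /=.
  move=> ->; exists [::] => // Z b [bl _]; rewrite !big_nil addr0.
  by have := bl v (-1) 0 0; rewrite scaler0 addr0 scaleN1r addNr.
move=> [c /IH[l' szl' hl']]; exists ((p.1, p.2 + c *: v) :: l').
  by rewrite /= szl'.
move=> Z b hb; have [bl br] := hb.
rewrite !big_cons -hl' //= [p.2 + _]addrC br.
have -> : b (u - c *: p.1) v = b u v - c *: b p.1 v.
  by have := bl v (- c) p.1 u; rewrite !scaleNr [- _ + u]addrC [- _ + b _ _]addrC.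
by rewrite [in RHS]addrACA [_ + (_ - _)]addrC subrK.
Qed.

(** A list of pairs stands for the tensor that is the sum of [p.1 (x) p.2]. If
    contracting the first factor with every functional gives zero, then the
    tensor is zero. By induction on its length: either the head factor [u] is
    separated from the others by a functional, and then its partner is zero, or
    the head can be absorbed. *)
Lemma tensor_eq0 V W (l : seq (V * W)) :
  (forall f : {linear V -> K^o}, \sum_(p <- l) (f p.1 : K) *: p.2 = 0) ->
  forall Z (b : V -> W -> Z), bilin b -> \sum_(p <- l) b p.1 p.2 = 0.
Proof.
move: {2}(size l) (leqnn (size l)) => m.
elim: m l => [|m IH] [|[u v] l] //= szl hl Z b hb; rewrite ?big_nil //.
rewrite big_cons /=.
have [uin|/(separation (in_span_submodule _))] :=
  pselect (in_span [seq p.1 | p <- l] u).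
  have [l' szl' hl'] := tensor_absorb v uin.
  rewrite hl' //; apply: IH; rewrite ?szl' // => f.
  rewrite -(hl' W (fun x y => (f x : K) *: y)).
    by have := hl f; rewrite big_cons.
  split=> [w a x y|x a w w'] /=; first by rewrite linearP scalerDl -scalerA.
  by rewrite scalerDr !scalerA mulrC.
move=> [f fl fu]; have v0 : v = 0.
  have := hl f; rewrite big_cons /= fu scale1r big_seq big1 ?addr0 // => p pl.
  by rewrite fl ?scale0r //; apply: in_span_mem; apply: map_f.
have b0 : b u v = 0.
  by have := hb.2 u (-1) 0 0; rewrite v0 scaler0 addr0 scaleN1r addNr.
rewrite b0 add0r; apply: IH => // g.
by have := hl g; rewrite big_cons /= v0 scaler0 add0r.
Qed.
End LinearAlgebra.

(** * The kernel of the multiplication of a free algebra *)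

Section AlgebraBasics.
Variable K : fieldType.
Implicit Types A B : naAlgType K.

Lemma namul_bilin A : bilin (@namul K A).
Proof.
have [hl hr] := @namul_bilinear K A.
by split=> [w a x y|v a x y]; [have := hl w a x y|have := hr v a x y].
Qed.

Lemma namulDl A (x y z : A) : namul (x + y) z = namul x z + namul y z.
Proof. by have := (namul_bilin A).1 z 1 x y; rewrite !scale1r. Qed.

Lemma namulDr A (x y z : A) : namul x (y + z) = namul x y + namul x z.
Proof. by have := (namul_bilin A).2 x 1 y z; rewrite !scale1r. Qed.

Lemma namul0l A (z : A) : namul 0 z = 0.
Proof. by apply: (addrI (namul 0 z)); rewrite -namulDl !addr0. Qed.

Lemma namul0r A (z : A) : namul z 0 = 0.
Proof. by apply: (addrI (namul z 0)); rewrite -namulDr !addr0. Qed.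

Lemma namulZl A a (x z : A) : namul (a *: x) z = a *: namul x z.
Proof. by have := (namul_bilin A).1 z a x 0; rewrite !addr0 namul0l addr0. Qed.

Lemma namulZr A a (x z : A) : namul x (a *: z) = a *: namul x z.
Proof. by have := (namul_bilin A).2 x a z 0; rewrite !addr0 namul0r addr0. Qed.

Lemma namul_suml A I (r : seq I) (P : pred I) (u : I -> A) z :
  namul (\sum_(i <- r | P i) u i) z = \sum_(i <- r | P i) namul (u i) z.
Proof.
elim/big_ind2: _ => [|x1 x2 y1 y2 <- <-|//]; first exact: namul0l.
exact: namulDl.
Qed.

Lemma namul_sumr A I (r : seq I) (P : pred I) (u : I -> A) z :
  namul z (\sum_(i <- r | P i) u i) = \sum_(i <- r | P i) namul z (u i).
Proof.
elim/big_ind2: _ => [|x1 x2 y1 y2 <- <-|//]; first exact: namul0r.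
exact: namulDr.
Qed.

Lemma rpowS A k (x : A) : (0 < k)%N -> rpow k.+1 x = namul x (rpow k x).
Proof. by case: k. Qed.

Lemma rpow_morph A B (phi : A -> B) k x :
  multiplicative phi -> phi (rpow k x) = rpow k (phi x).
Proof.
by move=> hphi; rewrite /rpow; elim: k.-1 => //= j IH; rewrite hphi IH.
Qed.

Definition subalgebra_of A (P : A -> Prop) (hP : submodule P)
    (hM : forall x y, P x -> P y -> P (namul x y)) : subalgebra A.
Proof.
refine (@Subalgebra K A (fun x => P x) _ _).
  split; first by rewrite inE; apply: (proj1 hP).
  by move=> a x y; rewrite !inE => Px Py; apply: (proj2 hP).
by move=> x y; rewrite !inE; apply: hM.
Defined.

Lemma right_nil_subalg n A (S : subalgebra A) :
  right_nil n A -> right_nil n (subalg_type S).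
Proof.
move=> hA x; apply: val_inj; rewrite linear0 -(hA (val x)).
exact: (@rpow_morph (subalg_type S) A (fun u => val u) n x).
Qed.

(** The subalgebra of elements satisfying [P] receives a homomorphism from [F]
    that fixes the generators; followed by the inclusion it is the identity. *)
Lemma free_generated n (F : naAlgType K) (X : Type) (iota : X -> F)
    (P : F -> Prop) :
  free_on (right_nil n) iota -> submodule P ->
  (forall x y, P x -> P y -> P (namul x y)) -> (forall x, P (iota x)) ->
  forall a, P a.
Proof.
move=> [nilF univF] hP hM hX a.
pose S := subalgebra_of hP hM.
have iS x : iota x \in subalg_pred S by apply/mem_set/hX.
have [[phi [phiM phiX]] _] := univF _ (@right_nil_subalg n F S nilF)
  (fun x => exist _ (iota x) (iS x)).
have [_ uniq] := univF F nilF iota.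
have lin1 : linear (fun x => val (phi x) : F).
  by move=> c x y; rewrite !linearP.
have E : val (phi a) = a.
  apply: (uniq (mklin lin1) idfun) => //=.
  - by move=> x y /=; rewrite phiM.
  - by move=> x /=; rewrite phiX.
by have := valP (phi a); rewrite E => /set_mem.
Qed.

End AlgebraBasics.


Section NullExtension.
Variables (K : fieldType) (A : naAlgType K) (W : lmodType K).
Variables (b : A -> A -> W) (hb : bilin b).

(** The extension of [A] by the null ideal [W], with product
    [(x, v)(y, w) = (xy, b(x, y))]. The cocycle [b] is a parameter of the type so
    that it determines the product. *)
Definition null_extension of bilin b := (A * W)%type.
HB.instance Definition _ := GRing.Lmodule.on (null_extension hb).

Definition null_extension_mul (x y : null_extension hb) : null_extension hb :=
  (namul x.1 y.1, b x.1 y.1).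

Lemma null_extension_bilinear : bilinear_for *:%R *:%R null_extension_mul.
Proof.
have [al ar] := namul_bilin A; have [bl br] := hb.
by split=> [v a x y|v a x y]; rewrite /null_extension_mul /=;
  [rewrite al bl|rewrite ar br].
Qed.

HB.instance Definition _ :=
  Lmodule_isNonAssocAlgebra.Build K (null_extension hb) null_extension_bilinear.

Lemma rpow_null_extension k (x : null_extension hb) : (1 < k)%N ->
  rpow k x = (rpow k x.1, b x.1 (rpow k.-1 x.1)).
Proof.
have E1 j : (rpow j x).1 = rpow j x.1.
  by rewrite /rpow; elim: j.-1 => //= i ->.
case: k => [|[|k]] // _; rewrite rpowS //.
change (null_extension_mul x (rpow k.+1 x) =
  (rpow k.+2 x.1, b x.1 (rpow k.+1 x.1))).
by rewrite /null_extension_mul E1.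
Qed.

Lemma right_nil_null_extension n : (1 < n)%N -> right_nil n A ->
  (forall x, b x (rpow n.-1 x) = 0) -> right_nil n (null_extension hb).
Proof. by move=> n1 hA hx x; rewrite rpow_null_extension // hA hx. Qed.

End NullExtension.

Section FreeKernel.
Variables (K : fieldType) (n : nat) (n1 : (1 < n)%N) (F : naAlgType K).
Variables (X : Type) (iota : X -> F).
Hypothesis freeF : free_on (right_nil n) iota.

(** The homomorphism from [F] to the null extension that lifts the generators has
    the identity as first component and the required map as second. *)
Lemma free_bilinear_lift (W : lmodType K) (b : F -> F -> W) : bilin b ->
  (forall x, b x (rpow n.-1 x) = 0) ->
  exists g : {linear F -> W}, forall x y, g (namul x y) = b x y.
Proof.
move=> hb hx; have [nilF univF] := freeF.
have [[phi [phiM phiX]] _] := univF _ (@right_nil_null_extension _ _ _ _ hb _ n1 nilF hx)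
  (fun x => (iota x, 0)).
have [_ uniq] := univF F nilF iota.
have lin1 : linear (fun x => (phi x).1 : F) by move=> a x y; rewrite linearP.
have lin2 : linear (fun x => (phi x).2 : W) by move=> a x y; rewrite linearP.
have E x : (phi x).1 = x.
  apply: (uniq (mklin lin1) idfun) => //=.
  - by move=> y z /=; rewrite phiM.
  - by move=> y /=; rewrite phiX.
by exists (mklin lin2) => x y; rewrite /= phiM /= !E.
Qed.

(** The kernel of the multiplication [F (x) F -> F] is spanned by the tensors
    [a (x) rpow n.-1 a]: apply the lifting property to the quotient of the tensor
    square by this span, where both tensors are read through functionals of the
    first factor. *)
Lemma free_kernel (l : seq (F * F)) : \sum_(p <- l) namul p.1 p.2 = 0 ->
  exists t : seq (K * F), forall f : {linear F -> K^o},
    \sum_(p <- l) (f p.1 : K) *: p.2 =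
    \sum_(q <- t) (q.1 * f q.2) *: rpow n.-1 q.2.
Proof.
move=> l0.
pose tens (x y : F) : {linear F -> K^o} -> F := fun f => (f x : K) *: y.
have tensP : bilin tens.
  split=> [w a x y|v a x y]; apply/funext=> f; rewrite /tens.
    by rewrite linearP scalerDl -scalerA.
  by rewrite scalerDr scalerA mulrC -scalerA.
pose R (g : {linear F -> K^o} -> F) := exists t : seq (K * F),
  g = \sum_(q <- t) q.1 *: tens q.2 (rpow n.-1 q.2).
have hR : submodule R.
  split; first by exists [::]; rewrite big_nil.
  move=> a _ _ [t ->] [t' ->]; exists ([seq (a * q.1, q.2) | q <- t] ++ t').
  rewrite big_cat big_map /= scaler_sumr; congr (_ + _).
  by apply: eq_bigr => q _; rewrite scalerA.
have [q qR Rq] := quotient_section hR.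
have [||g hg] := @free_bilinear_lift _ (fun x y => q (tens x y)).
- have [tl tr] := tensP.
  by split=> [w a x y|v a x y]; rewrite ?tl ?tr linearP.
- move=> x; apply: qR; exists [:: (1, x)].
  by rewrite big_seq1 scale1r.
have [t E] : R (\sum_(p <- l) tens p.1 p.2).
  have q0 : q (\sum_(p <- l) tens p.1 p.2) = 0.
    rewrite linear_sum; transitivity (g (\sum_(p <- l) namul p.1 p.2)).
      by rewrite linear_sum; apply: eq_bigr => p _; rewrite hg.
    by rewrite l0 linear0.
  by have := Rq (\sum_(p <- l) tens p.1 p.2); rewrite q0 subr0.
exists t => f; have := congr1 (fun h => h f) E.
rewrite !fct_sumE => ->; apply: eq_bigr => p _.
by rewrite /tens fctE /= scalerA.
Qed.

End FreeKernel.

(** * Gradings *)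

Section Grading.
Variable K : fieldType.

Record grading (A : naAlgType K) (pi : nat -> {linear A -> A}) : Prop := {
  grading_sum : forall a, exists M, forall N, (M <= N)%N ->
    a = \sum_(i < N) pi i a;
  grading_proj : forall i j a, pi i (pi j a) = if i == j then pi j a else 0;
  grading_mul : forall m x y,
    pi m (namul x y) = \sum_(i < m.+1) namul (pi i x) (pi (m - i)%N y);
  grading_pos : forall a, pi 0%N a = 0
}.

(** A polynomial with vector coefficients vanishing at all natural numbers,
    which are distinct in characteristic zero, has zero coefficients. *)
Lemma vandermonde_eq0 (V : lmodType K) (c : nat -> V) N :
  [pchar K] =i pred0 ->
  (forall a : K, \sum_(i < N) a ^+ i *: c i = 0) ->
  forall i, (i < N)%N -> c i = 0.
Proof.
move=> /pcharf0P K0 hc i iN; apply: separates0 => f.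
pose p := \poly_(j < N) (f (c j) : K).
have p0 : p = 0.
  apply/eqP/negPn/negP => np.
  suff : (size [seq j%:R : K | j <- iota 0 (size p)] < size p)%N.
    by rewrite size_map size_iota ltnn.
  apply: max_poly_roots => //.
    apply/allP => _ /mapP[j _ ->]; rewrite /root horner_poly.
    rewrite -[X in _ == X](linear0 f) -(hc j%:R) linear_sum.
    by apply/eqP/eq_bigr => k _; rewrite linearZ /= mulrC.
  rewrite map_inj_uniq ?iota_uniq // => x y /eqP.
  wlog xy : x y / (x <= y)%N.
    move=> h; case/orP: (leq_total x y); first exact: h.
    by move=> yx E; symmetry; apply: h => //; rewrite eq_sym.
  rewrite eq_sym -subr_eq0 -natrB // K0 subn_eq0 => yx.
  by apply/eqP; rewrite eqn_leq xy.
have := congr1 (fun q : {poly K} => q`_i) p0.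
by rewrite coef_poly iN coef0.
Qed.

Lemma triangular_sum (V : nmodType) N (g : nat -> nat -> V) :
  \sum_(m < N) \sum_(i < m.+1) g i (m - i)%N =
  \sum_(i < N) \sum_(j < N - i) g i j.
Proof.
elim: N => [|N IH]; first by rewrite !big_ord0.
rewrite big_ord_recr IH /= [RHS]big_ord_recr /= subSnn big_ord1.
rewrite [X in _ + X]big_ord_recr /= subnn addrA; congr (_ + _).
rewrite -big_split; apply: eq_bigr => i _ /=.
by rewrite subSn 1?ltnW // big_ord_recr.
Qed.

Lemma cauchy_product (A : naAlgType K) (u v : nat -> A) M M' N :
  (forall i, (M <= i)%N -> u i = 0) -> (forall i, (M' <= i)%N -> v i = 0) ->
  (M + M' <= N)%N ->
  \sum_(m < N) \sum_(i < m.+1) namul (u i) (v (m - i)%N) =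
  namul (\sum_(i < N) u i) (\sum_(j < N) v j).
Proof.
move=> u0 v0 MN; rewrite (triangular_sum N (fun i j => namul (u i) (v j))).
rewrite namul_suml; apply: eq_bigr => i _; rewrite namul_sumr.
have iN := ltnW (ltn_ord i).
rewrite -(big_mkord xpredT (fun j => namul (u i) (v j))).
rewrite -[RHS](big_mkord xpredT (fun j => namul (u i) (v j))).
rewrite [RHS](@big_cat_nat _ _ _ (N - i)) ?leq_subr //=.
rewrite [X in _ + X]big_nat [X in _ + X]big1 ?addr0 // => j /andP[ij _].
have [Mi|iM] := leqP M i; first by rewrite u0 // namul0l.
rewrite v0 ?namul0r //; lia.
Qed.

Section FreeGrading.
Variables (n : nat) (F : naAlgType K) (X : Type) (iota : X -> F) (w : X -> nat).
Hypothesis K0 : [pchar K] =i pred0.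
Hypothesis freeF : free_on (right_nil n) iota.
Hypothesis w0 : forall x, (0 < w x)%N.

(** Give the generator [x] degree [w x]. For each scalar [a], multiplying every
    generator by [a ^+ w x] extends to an endomorphism [s a], which must act on
    degree [i] as [a ^+ i]. So the components of [x] are recovered as the
    coefficients of [s a x] as a polynomial in [a]. *)
Lemma free_grading : exists2 pi : nat -> {linear F -> F},
  grading pi & forall x, pi (w x) (iota x) = iota x.
Proof.
have [nilF univF] := freeF.
have /choice[s sP] : forall a : K, exists phi : {linear F -> F},
    multiplicative phi /\ forall x, phi (iota x) = a ^+ w x *: iota x.
  by move=> a; have [] := univF F nilF (fun x => a ^+ w x *: iota x).
have sM a : multiplicative (s a) by have [] := sP a.
have sX a x : s a (iota x) = a ^+ w x *: iota x by have [_ ->] := sP a.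
pose Q x (c : nat -> F) := exists M, forall N, (M <= N)%N ->
  forall a, s a x = \sum_(i < N) a ^+ i *: c i.
have Qfin x c : Q x c -> exists M, forall i, (M <= i)%N -> c i = 0.
  move=> [M hM]; exists M => i Mi; have := hM i.+1 (leqW Mi) 1.
  rewrite big_ord_recr -(hM i Mi 1) /= expr1n scale1r.
  by rewrite -[LHS]addr0 => /addrI <-.
have Quniq x c c' : Q x c -> Q x c' -> forall i, c i = c' i.
  move=> [M hM] [M' hM'] i; apply/eqP; rewrite -subr_eq0; apply/eqP.
  apply: (@vandermonde_eq0 F (fun i => c i - c' i) (i + M + M').+1) => //;
    last by lia.
  move=> a; under eq_bigr do rewrite scalerBr.
  by rewrite sumrB -hM ?leqW -?hM' ?subrr //; lia.
have Qlin a x y c c' : Q x c -> Q y c' -> Q (a *: x + y) (fun i => a *: c i + c' i).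
  move=> [M hM] [M' hM']; exists (M + M')%N => N MN b.
  rewrite linearP (hM N) ?(hM' N); try lia.
  rewrite scaler_sumr -big_split; apply: eq_bigr => i _ /=.
  by rewrite scalerDr !scalerA mulrC.
have Qmul x y c c' : Q x c -> Q y c' ->
    Q (namul x y) (fun m => \sum_(i < m.+1) namul (c i) (c' (m - i)%N)).
  move=> Qx Qy; have [[M0 f0] [M0' f0']] := (Qfin _ _ Qx, Qfin _ _ Qy).
  have [[M hM] [M' hM']] := (Qx, Qy).
  exists (M + M' + M0 + M0')%N => N MN a.
  rewrite sM (hM N) ?(hM' N); try lia.
  rewrite -(@cauchy_product _ (fun i => a ^+ i *: c i)
    (fun i => a ^+ i *: c' i) M0 M0'); try lia.
  - apply: eq_bigr => m _; rewrite scaler_sumr; apply: eq_bigr => i _.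
    rewrite namulZl namulZr scalerA -exprD subnKC //.
    by rewrite -ltnS.
  - by move=> i /f0 ->; rewrite scaler0.
  - by move=> i /f0' ->; rewrite scaler0.
have QX x : Q (iota x) (fun i => if i == w x then iota x else 0).
  exists (w x).+1 => N wN a; rewrite sX (bigD1 (Ordinal wN)) //= eqxx.
  rewrite big1 ?addr0 // => i; rewrite -val_eqE /= => /negbTE ->.
  by rewrite scaler0.
have /choice[p pP] : forall x, exists c, Q x c.
  apply: (free_generated freeF).
  - split; last by move=> a x y [c Qc] [c' Qc']; eexists; apply: Qlin; eassumption.
    exists (fun=> 0), 0%N => N _ a; rewrite linear0 big1 // => i _.
    by rewrite scaler0.
  - by move=> x y [c Qc] [c' Qc']; eexists; apply: Qmul; eassumption.
  - by move=> x; eexists; apply: QX.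
have pE x c : Q x c -> forall i, p x i = c i by apply: Quniq.
have plin i : linear (fun x => p x i).
  by move=> a x y; rewrite (pE _ _ (Qlin a _ _ _ _ (pP x) (pP y))).
exists (fun i => mklin (plin i)) => [|x] /=; last first.
  by rewrite (pE _ _ (QX x)) eqxx.
split=> /=.
- move=> a; have [M hM] := pP a; exists M => N MN.
  have s1 : s 1 a = a.
    apply: (proj2 (univF F nilF iota) (s 1) idfun) => // x.
    by rewrite sX expr1n scale1r.
  rewrite -[LHS]s1 (hM N MN); apply: eq_bigr => i _.
  by rewrite expr1n scale1r.
- move=> i j x.
  (* The coefficients of [s (a * b) x = s b (s a x)] are compared. *)
  have spj b : s b (p x j) = b ^+ j *: p x j.
    have [M hM] := pP x.
    have [M' hM'] := Qfin _ _ (pP x).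
    pose N := (j + M).+1.
    apply/eqP; rewrite -subr_eq0; apply/eqP.
    apply: (@vandermonde_eq0 F (fun j => s b (p x j) - b ^+ j *: p x j) N)
      => //; last by rewrite /N; lia.
    move=> a; under eq_bigr do rewrite scalerBr.
    rewrite sumrB; apply/eqP; rewrite subr_eq0; apply/eqP.
    transitivity (s b (s a x)).
      rewrite (hM N) /N; last by lia.
      by rewrite linear_sum; apply: eq_bigr => k _; rewrite linearZ.
    have -> : s b (s a x) = s (a * b) x.
      apply: (proj2 (univF F nilF (fun x => (a * b) ^+ w x *: iota x))
        (s b \o s a) (s (a * b))) => //=.
      - by move=> u v; rewrite /= !sM.
      - by move=> u; rewrite sX linearZ /= sX scalerA exprMn.
    rewrite (hM N) /N; last by lia.
    by apply: eq_bigr => k _; rewrite exprMn scalerA.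
  rewrite (@pE _ (fun i => if i == j then p x j else 0)) //.
  exists j.+1 => N jN a; rewrite spj (bigD1 (Ordinal jN)) //= eqxx.
  rewrite big1 ?addr0 // => k; rewrite -val_eqE /= => /negbTE ->.
  by rewrite scaler0.
- by move=> m x y; rewrite (pE _ _ (Qmul _ _ _ _ (pP x) (pP y))).
- apply: (free_generated freeF).
  + split=> [|a x y hx hy]; first exact: (linear0 (mklin (plin 0%N))).
    by rewrite (pE _ _ (Qlin a _ _ _ _ (pP x) (pP y))) hx hy scaler0 addr0.
  + move=> x y hx hy; rewrite (pE _ _ (Qmul _ _ _ _ (pP x) (pP y))).
    by rewrite big_ord1 hx namul0l.
  + by move=> x; rewrite (pE _ _ (QX x)) ltn_eqF.
Qed.
End FreeGrading.
End Grading.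

(** * Symmetric powers of a graded algebra *)

Section SymmetricPowers.
Variables (K : fieldType) (n : nat) (n1 : (1 < n)%N) (A : naAlgType K).
Variable pi : nat -> {linear A -> A}.
Hypothesis gr : grading pi.
Hypothesis ker : forall l : seq (A * A), \sum_(p <- l) namul p.1 p.2 = 0 ->
  exists t : seq (K * A), forall f : {linear A -> K^o},
    \sum_(p <- l) (f p.1 : K) *: p.2 =
    \sum_(q <- t) (q.1 * f q.2) *: rpow n.-1 q.2.

Implicit Types (t : seq (K * A)) (p : nat * {linear A -> K^o}).
Implicit Types (fs : seq (nat * {linear A -> K^o})).

(** A list [t] of scalars [c] and vectors [a] stands for the symmetric tensor that
    is the sum of the [c a (x) ... (x) a], in any number of factors. Such a tensor
    is tested against a list [fs] of functionals, each applied to the component of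
    a prescribed degree; [weight fs] is the total degree of the tested part. *)
Definition sym_eval t fs : K :=
  \sum_(q <- t) q.1 * \prod_(p <- fs) (p.2 (pi p.1 q.2) : K).

(** The partial derivative of a symmetric tensor along a functional. *)
Definition contract p t : seq (K * A) :=
  [seq (q.1 * (p.2 (pi p.1 q.2) : K), q.2) | q <- t].

Definition weight fs := (\sum_(p <- fs) p.1)%N.

Lemma weight_cons p fs : weight (p :: fs) = (p.1 + weight fs)%N.
Proof. exact: big_cons. Qed.

Lemma sym_eval_cons t p fs : sym_eval t (p :: fs) = sym_eval (contract p t) fs.
Proof.
rewrite /sym_eval big_map; apply: eq_bigr => q _.
by rewrite big_cons mulrA.
Qed.

Lemma sym_eval_swap t p q fs :
  sym_eval t (p :: q :: fs) = sym_eval t (q :: p :: fs).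
Proof. by apply: eq_bigr => a _; rewrite !big_cons [p.2 _ * _]mulrCA. Qed.

Lemma sym_eval_weight0 t fs : (0 < size fs)%N -> weight fs = 0%N ->
  sym_eval t fs = 0.
Proof.
case: fs => // p fs _; rewrite weight_cons => /eqP; rewrite addn_eq0.
case/andP=> /eqP p0 _; apply: big1 => q _.
by rewrite big_cons p0 (grading_pos gr) linear0 mul0r mulr0.
Qed.

Lemma pi_rpow m k x : (0 < k)%N -> pi m (rpow k.+1 x) =
  \sum_(i < m.+1) namul (pi i x) (pi (m - i)%N (rpow k x)).
Proof. by move=> k0; rewrite rpowS // (grading_mul gr). Qed.

(** The map from the [k]-th symmetric power to [A] that sends [a (x) ... (x) a] to
    [rpow k a] is well defined in each degree. *)
Lemma rpow_sum_eq0 k m t : (0 < k)%N ->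
  (forall fs, size fs = k -> weight fs = m -> sym_eval t fs = 0) ->
  \sum_(q <- t) q.1 *: pi m (rpow k q.2) = 0.
Proof.
elim: k m t => // -[|k] IH m t _ ht.
  apply: separates0 => f; have := ht [:: (m, f)] erefl.
  rewrite weight_cons /weight big_nil addn0 => /(_ erefl) E; rewrite -[RHS]E.
  rewrite linear_sum; apply: eq_bigr => q _.
  by rewrite big_seq1 linearZ.
under eq_bigr do rewrite pi_rpow // scaler_sumr.
rewrite exchange_big big1 //= => i _.
under eq_bigr do rewrite -namulZl.
pose l := [seq (q.1 *: pi i q.2, pi (m - i)%N (rpow k.+1 q.2)) | q <- t].
have := @tensor_eq0 _ _ _ l _ _ _ (namul_bilin A).
rewrite !big_map; apply=> f; rewrite big_map /=.
rewrite -[RHS](IH (m - i)%N (contract (i : nat, f) t)) // => [|fs szfs wfs].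
  by rewrite big_map; apply: eq_bigr => q _; rewrite linearZ.
rewrite -sym_eval_cons; apply: ht; first by rewrite /= szfs.
by rewrite weight_cons wfs /= subnKC // -ltnS.
Qed.

(** The description of the kernel of multiplication, one bidegree at a time. *)
Lemma homogeneous_kernel (l : seq (A * A)) m :
  pi m (\sum_(p <- l) namul p.1 p.2) = 0 ->
  exists t, forall (f : {linear A -> K^o}) j, (j <= m)%N ->
    \sum_(p <- l) (f (pi j p.1) : K) *: pi (m - j)%N p.2 =
    \sum_(q <- contract (j, f) t) q.1 *: pi (m - j)%N (rpow n.-1 q.2).
Proof.
move=> l0.
pose r := index_iota 0 m.+1.
pose l' := [seq (pi i u.1, pi (m - i)%N u.2) | u <- l, i <- r].
have [|t ht] := ker (l := l').
  rewrite big_allpairs_dep /= -[RHS]l0 linear_sum; apply: eq_bigr => u _.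
  by rewrite (grading_mul gr) -(big_mkord xpredT (fun i =>
    namul (pi i u.1) (pi (m - i)%N u.2))).
exists t => f j jm; have := ht (f \o pi j).
rewrite big_allpairs_dep big_map /=.
move/(congr1 (pi (m - j)%N)); rewrite !linear_sum.
have -> : \sum_(q <- t) pi (m - j)%N ((q.1 * (f (pi j q.2) : K)) *:
     rpow n.-1 q.2) =
  \sum_(q <- t) (q.1 * (f (pi j q.2) : K)) *: pi (m - j)%N (rpow n.-1 q.2).
  by apply: eq_bigr => q _; rewrite linearZ.
move=> <-; apply: eq_bigr => p _.
rewrite (bigD1_seq j) ?iota_uniq ?mem_index_iota //=.
rewrite big1 ?addr0 => [|i ij].
  by rewrite (grading_proj gr) eqxx linearZ /= (grading_proj gr) eqxx.
by rewrite (grading_proj gr) eq_sym (negbTE ij) linear0 scale0r.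
Qed.

(** The heart of the proof: in total, the symmetric powers of exponents
    [2, ..., n - 1] embed into [A]. By induction on the degree [N]. A relation
    between the [rpow k a] is a relation between products [a (rpow k.-1 a)], so
    the kernel of multiplication provides symmetric tensors [L' k], now for
    [2 <= k <= n], such that differentiating all of them along any functional
    of degree [j] yields a relation in degree [N - j] ([star]). Let [D] be the
    largest degree of a factor of some [L' k]. If [D] occurs for a [k >= 3], then
    it survives differentiation along another factor, of some degree [j] with
    [N - j > D]; the linear term of the differentiated relation then vanishes as
    [D] is maximal, contradicting the induction hypothesis. If [D] occurs for
    [k = 2] only, then differentiating along degree [D] leaves nothing but the
    linear term, which is therefore zero. *)
Lemma sym_powers_independent N (L : nat -> seq (K * A)) :
  \sum_(2 <= k < n) \sum_(q <- L k) q.1 *: pi N (rpow k q.2) = 0 ->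
  forall k fs, (2 <= k < n)%N -> size fs = k -> weight fs = N ->
  sym_eval (L k) fs = 0.
Proof.
elim/ltn_ind: N L => N IHN L hL.
pose l := [seq (q.1 *: q.2, rpow k.-1 q.2) | k <- index_iota 2 n, q <- L k].
have [|t ht] := @homogeneous_kernel l N.
  rewrite big_allpairs_dep -[RHS]hL linear_sum; apply: eq_big_seq => k.
  rewrite mem_index_iota => /andP[k2 _]; rewrite linear_sum.
  apply: eq_bigr => q _; rewrite /= namulZl linearZ -rpowS; last by lia.
  by rewrite prednK //; lia.
pose L' k := if k == n then [seq (- q.1, q.2) | q <- t] else L k.
have star p : (p.1 <= N)%N ->
    \sum_(1 <= k < n) \sum_(q <- contract p (L' k.+1))
      q.1 *: pi (N - p.1)%N (rpow k q.2) = 0.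
  move=> pN; case: p pN => j f /= jN; have := ht f j jN.
  rewrite big_allpairs_dep /= => E.
  rewrite -(prednK (ltnW n1)) big_nat_recr /=; last by lia.
  rewrite prednK ?(ltnW n1) // /L' eqxx; apply/eqP; rewrite addr_eq0; apply/eqP.
  rewrite !big_map; transitivity (\sum_(q <- contract (j, f) t)
      q.1 *: pi (N - j)%N (rpow n.-1 q.2)).
    rewrite -E -{1}[n in RHS](prednK (ltnW n1)) [RHS]big_add1 /=.
    apply: eq_big_nat => k kn.
    rewrite ifF; last by apply/eqP; lia.
    rewrite big_map; apply: eq_bigr => q _ /=.
    by rewrite !linearZ.
  rewrite big_map -sumrN; apply: eq_bigr => q _ /=.
  by rewrite mulNr scaleNr opprK.
(* Descending induction on the degree [p.1] of the distinguished factor, [e]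
   measuring its distance to [N + 1]. *)
have main e : forall k p fs, (2 <= k <= n)%N -> (size fs).+1 = k ->
    (p.1 + weight fs)%N = N -> (N < p.1 + e)%N -> sym_eval (L' k) (p :: fs) = 0.
  elim: e => [|e IHe] k p fs hk szfs wfs Ne; first lia.
  have [Ne'|eN] := ltnP N (p.1 + e); first exact: (IHe k).
  have {Ne eN} eE : (p.1 + e)%N = N by lia.
  have big3 k' fs' : (3 <= k' <= n)%N -> (size fs').+1 = k' ->
      (p.1 + weight fs')%N = N -> sym_eval (L' k') (p :: fs') = 0.
    case: fs' => [|q fs'] hk' szfs' wfs'; first by move: hk'; rewrite -szfs'.
    move: wfs'; rewrite weight_cons => wfs'.
    have [w0|w0] := posnP (weight fs').
      rewrite !sym_eval_cons sym_eval_weight0 //.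
      by case: fs' szfs' hk' {w0 wfs'} => //=; lia.
    have [q0|q0] := posnP q.1.
      rewrite sym_eval_swap; apply: big1 => a _.
      by rewrite big_cons q0 (grading_pos gr) linear0 mul0r mulr0.
    rewrite sym_eval_swap sym_eval_cons.
    have := @IHN (N - q.1)%N _ (fun k => contract q (L' k.+1)) _ k'.-1 (p :: fs').
    rewrite prednK; last by lia.
    apply; rewrite ?weight_cons /=; try lia; try by rewrite -szfs'.
    rewrite -[RHS](star q) ?[RHS]big_ltn //; try lia.
    rewrite -[LHS]add0r; congr (_ + _); symmetry.
    (* The linear term: a factor of degree [N - q.1 > p.1] would occur in [L' 2]. *)
    apply: separates0 => h.
    rewrite -[RHS](IHe 2 ((N - q.1)%N, h) [:: q]) //=; last first.
    - lia.
    - by rewrite /weight big_seq1; lia.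
    rewrite sym_eval_swap sym_eval_cons linear_sum.
    by apply: eq_bigr => a _; rewrite big_seq1 linearZ.
  have [k3|k2] := leqP 3 k; first by apply: (big3 k) => //; lia.
  have {}k2 : k = 2%N by lia.
  move: szfs wfs; rewrite k2; case: fs => [|h [|]] // _.
  rewrite weight_cons /weight big_nil => wfs.
  have := star p; rewrite big_ltn // [X in _ + X]big_nat [X in _ + X]big1 ?addr0.
    move=> E; have hN : h.1 = (N - p.1)%N by lia.
    rewrite sym_eval_cons -[RHS](linear0 h.2) -E; last by lia.
    rewrite linear_sum; apply: eq_bigr => a _.
    by rewrite big_seq1 hN linearZ.
  move=> k' hk'; apply: rpow_sum_eq0; first by lia.
  move=> fs szfs w; rewrite -sym_eval_cons; apply: (big3 k'.+1); try lia.
move=> k fs hk szfs wfs.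
have <- : L' k = L k by rewrite /L' ifF //; apply/eqP; lia.
case: fs szfs wfs => [|p fs] szfs; first by move: hk; rewrite -szfs.
rewrite weight_cons => wfs; apply: (main N.+1) => //; lia.
Qed.

(** Only the exponent [n - 1] matters below. For [n = 2] it is [1], and the map
    is the identity. *)
Lemma sym_power_injective N t :
  \sum_(q <- t) q.1 *: pi N (rpow n.-1 q.2) = 0 ->
  forall fs, size fs = n.-1 -> weight fs = N -> sym_eval t fs = 0.
Proof.
move=> t0 fs szfs wfs; have [n2|n3] := leqP n 2.
  have nE : n = 2%N by lia.
  move: szfs t0; rewrite nE; case: fs wfs => [|h [|]] // wfs _ t0.
  move: wfs; rewrite weight_cons /weight big_nil addn0 => wfs.
  rewrite -[RHS](linear0 h.2) -t0 linear_sum; apply: eq_bigr => q _.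
  by rewrite big_seq1 wfs linearZ.
have := @sym_powers_independent N (fun k => if k == n.-1 then t else [::]).
move=> /(_ _ n.-1 fs); rewrite eqxx; apply=> //; last by lia.
rewrite -(prednK (ltnW n1)) big_nat_recr /=; last by lia.
rewrite eqxx t0 addr0 big_nat big1 // => k hk.
by rewrite ifF ?big_nil //; apply/eqP; lia.
Qed.


(** If a symmetric tensor is killed by differentiation along the functionals
    that vanish on [H], then it is unchanged by a graded projection [P] onto [H],
    that is, it lies in the symmetric power of [H]. *)
Lemma sym_eval_project (H : A -> Prop) (u : {linear A -> A}) (P : A -> A) N :
  (forall x, H x -> u x = 0) ->
  (forall j x, (j <= N)%N -> pi j (P x) = pi j x - pi j (u (pi j x))) ->
  forall fs t, (weight fs <= N)%N ->
  (forall (f : {linear A -> K^o}) j fs', (forall x, H x -> f x = 0) ->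
     (size fs').+1 = size fs -> (j + weight fs')%N = weight fs ->
     sym_eval t ((j, f) :: fs') = 0) ->
  sym_eval [seq (q.1, P q.2) | q <- t] fs = sym_eval t fs.
Proof.
move=> uH hP; elim=> [|[j f] fs IH] t wfs ht.
  by rewrite /sym_eval big_map; apply: eq_bigr => q _; rewrite !big_nil.
move: (wfs); rewrite weight_cons /= => wjfs.
pose g : {linear A -> K^o} := f \o (pi j \o u).
pose f' : {linear A -> K^o} := f \- g.
have -> : sym_eval [seq (q.1, P q.2) | q <- t] ((j, f) :: fs) =
    sym_eval t ((j, f') :: fs).
  rewrite !sym_eval_cons -[RHS]IH; last first.
  - move=> h i fs' hH szfs' wfs'; rewrite -sym_eval_cons sym_eval_swap.
    apply: ht => //=; first by rewrite szfs'.
    by rewrite !weight_cons /= -wfs'; lia.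
  - lia.
  - congr sym_eval; rewrite /contract -!map_comp; apply: eq_map => q /=.
    by rewrite hP ?linearB //; lia.
have g0 : sym_eval t ((j, g) :: fs) = 0.
  by apply: ht; rewrite ?weight_cons // => x Hx; rewrite /= uH // !linear0.
rewrite -[RHS]subr0 -g0.
rewrite /sym_eval -sumrB; apply: eq_bigr => q _.
by rewrite !big_cons /= mulrBl mulrBr.
Qed.

(** For a graded subspace [H], relations among products with left factors in [H]
    come from the defining identity on [H] itself. Indeed a functional that
    vanishes on [H] kills the left factors, so the derivative along it of the
    symmetric tensor behind the relation goes to zero in [A], and is zero by
    injectivity. *)
Lemma kernel_in_submodule (H : A -> Prop) (l : seq (A * A)) N : submodule H ->
  (forall i x, H x -> H (pi i x)) -> (forall v, v \in l -> H v.1) ->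
  pi N (\sum_(v <- l) namul v.1 v.2) = 0 ->
  exists2 t, forall q, q \in t -> H q.2 &
    forall (f : {linear A -> K^o}) j, (j <= N)%N ->
    \sum_(v <- l) (f (pi j v.1) : K) *: pi (N - j)%N v.2 =
    \sum_(q <- contract (j, f) t) q.1 *: pi (N - j)%N (rpow n.-1 q.2).
Proof.
move=> hH piH lH /homogeneous_kernel[t ht].
have [u uH Hu] := quotient_section hH.
(* [id - u] projects onto [H]; its diagonal blocks make it graded. *)
pose P x := \sum_(i < N.+1) pi i (pi i x - u (pi i x)).
have PE j x : (j <= N)%N -> pi j (P x) = pi j x - pi j (u (pi j x)).
  move=> jN; rewrite linear_sum (bigD1 (Ordinal (jN : (j < N.+1)%N))) //=.
  rewrite big1 ?addr0 => [|i].
    by rewrite (grading_proj gr) eqxx linearB /= (grading_proj gr) eqxx.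
  by rewrite -val_eqE /= (grading_proj gr) eq_sym => /negbTE ->.
exists [seq (q.1, P q.2) | q <- t] => [_ /mapP[q _ ->]|f j jN] /=.
  by apply: submodule_sum => // i _; apply: piH; apply: Hu.
rewrite ht //; apply/eqP; rewrite -subr_eq0; apply/eqP.
pose t1 := contract (j, f) t.
pose t2 := contract (j, f) [seq (q.1, P q.2) | q <- t].
have ev fs : sym_eval (t1 ++ [seq (- q.1, q.2) | q <- t2]) fs =
    sym_eval t1 fs - sym_eval t2 fs.
  rewrite /sym_eval big_cat; congr (_ + _).
  by rewrite [LHS]big_map -sumrN; apply: eq_bigr => q _; rewrite mulNr.
have := @rpow_sum_eq0 n.-1 (N - j)%N (t1 ++ [seq (- q.1, q.2) | q <- t2]).
have -> : \sum_(q <- t1 ++ [seq (- q.1, q.2) | q <- t2])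
    q.1 *: pi (N - j)%N (rpow n.-1 q.2) =
  \sum_(q <- t1) q.1 *: pi (N - j)%N (rpow n.-1 q.2) -
  \sum_(q <- t2) q.1 *: pi (N - j)%N (rpow n.-1 q.2).
  rewrite big_cat; congr (_ + _).
  by rewrite [LHS]big_map -sumrN; apply: eq_bigr => q _; rewrite scaleNr.
apply=> [|fs szfs wfs]; first by lia.
rewrite ev -!sym_eval_cons; apply/eqP; rewrite subr_eq0 eq_sym; apply/eqP.
apply: (sym_eval_project uH PE); first by rewrite weight_cons wfs /=; lia.
move=> g i fs' gH szfs' wfs'; rewrite sym_eval_cons.
move: wfs'; rewrite weight_cons wfs /= => wfs'.
apply: (@sym_power_injective (N - i)%N); last by lia.
  rewrite -ht; last by lia.
  by rewrite big_seq big1 // => v /lH Hv; rewrite gH ?scale0r //; apply: piH.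
by move: szfs' => /= [->].
Qed.

End SymmetricPowers.

(** * Free algebras *)

Section Terms.
Variables (K : fieldType) (Y : Type).

Inductive term :=
  | TVar of Y
  | TZero
  | TAdd of term & term
  | TScale of K & term
  | TMul of term & term.

Fixpoint teval (B : naAlgType K) (f : Y -> B) (t : term) : B :=
  match t with
  | TVar y => f y
  | TZero => 0
  | TAdd t1 t2 => teval f t1 + teval f t2
  | TScale a t1 => a *: teval f t1
  | TMul t1 t2 => namul (teval f t1) (teval f t2)
  end.

HB.instance Definition _ := gen_eqMixin term.
HB.instance Definition _ := gen_choiceMixin term.
End Terms.

Section FreeAlgebra.
Variables (K : fieldType) (n : nat) (Y : Type).
Notation term := (term K Y).

(** Terms are identified when they take the same values in all algebras of the
    variety. Every identity of the variety, and every axiom of algebras, then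
    holds in the quotient because it holds in each of these algebras. *)
Definition teq (s t : term) : bool :=
  `[< forall B : naAlgType K, right_nil n B ->
      forall f : Y -> B, teval f s = teval f t >].

Lemma teq_equiv : equiv_class_of teq.
Proof.
split=> [s|s t|t s u /asboolP st /asboolP tu].
- exact/asboolP.
- by apply/asboolP/asboolP=> st B hB f; rewrite st.
- by apply/asboolP=> B hB f; rewrite st // tu.
Qed.

Canonical teq_equiv_rel := EquivRelPack teq_equiv.

Definition free_alg := {eq_quot teq_equiv_rel}%qT.
HB.instance Definition _ := Choice.on free_alg.

Definition class_of (t : term) : free_alg := (\pi_(free_alg) t)%qT.

Definition free_eval (B : naAlgType K) (f : Y -> B) (x : free_alg) : B :=
  teval f (repr x)%qT.

Lemma free_eval_class (B : naAlgType K) (f : Y -> B) t :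
  right_nil n B -> free_eval f (class_of t) = teval f t.
Proof.
move=> hB; rewrite /free_eval /class_of.
have /eqmodP /asboolP -> // : ((repr (\pi_(free_alg) t)) = t %[mod free_alg])%qT.
by rewrite reprK.
Qed.

Lemma free_eval_inj (x y : free_alg) :
  (forall B : naAlgType K, right_nil n B -> forall f : Y -> B,
     free_eval f x = free_eval f y) -> x = y.
Proof.
move=> h; rewrite -[x]reprK -[y]reprK; apply/eqmodP/asboolP => B hB f.
exact: h.
Qed.

Definition fadd (x y : free_alg) : free_alg := class_of (TAdd (repr x) (repr y))%qT.
Definition fscale (a : K) (x : free_alg) : free_alg := class_of (TScale a (repr x))%qT.
Definition fmul (x y : free_alg) : free_alg := class_of (TMul (repr x) (repr y))%qT.
Definition fzero := class_of (TZero K Y).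
Definition fopp := fscale (-1).

Let evalE := (free_eval_class).

Ltac by_eval := apply: free_eval_inj => B hB f;
  rewrite /fopp ?evalE //=; rewrite -?/(free_eval _ _) ?evalE //=;
  rewrite -?/(free_eval _ _).

Lemma faddA : associative fadd. Proof. by move=> x y z; by_eval; rewrite addrA. Qed.
Lemma faddC : commutative fadd. Proof. by move=> x y; by_eval; rewrite addrC. Qed.
Lemma fadd0 : left_id fzero fadd. Proof. by move=> x; by_eval; rewrite add0r. Qed.
Lemma faddN : left_inverse fzero fopp fadd.
Proof. by move=> x; by_eval; rewrite scaleN1r addNr. Qed.

HB.instance Definition _ :=
  GRing.isZmodule.Build free_alg faddA faddC fadd0 faddN.

Lemma fscaleA a b x : fscale a (fscale b x) = fscale (a * b) x.
Proof. by by_eval; rewrite scalerA. Qed.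
Lemma fscale1 : left_id 1 fscale. Proof. by move=> x; by_eval; rewrite scale1r. Qed.
Lemma fscaleDr : right_distributive fscale +%R.
Proof. by move=> a x y; by_eval; rewrite scalerDr. Qed.
Lemma fscaleDl x : {morph fscale^~ x : a b / a + b}.
Proof. by move=> a b; by_eval; rewrite scalerDl. Qed.

HB.instance Definition _ :=
  GRing.Zmodule_isLmodule.Build K free_alg fscaleA fscale1 fscaleDr fscaleDl.

Lemma free_eval_linear (B : naAlgType K) (f : Y -> B) :
  right_nil n B -> linear (free_eval f).
Proof.
move=> hB a x y.
have -> : a *: x + y = fadd (fscale a x) y by [].
by rewrite !evalE //= -!/(free_eval _ _) evalE.
Qed.

Lemma fmul_bilinear : bilinear_for *:%R *:%R fmul.
Proof.
have [bl br] : bilin fmul.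
  split=> u a x y; apply: free_eval_inj => B hB f;
    rewrite free_eval_linear // !evalE //= -!/(free_eval _ _);
    rewrite free_eval_linear //.
    by rewrite (namul_bilin B).1.
  by rewrite (namul_bilin B).2.
by split=> u a x y; rewrite /= ?bl ?br.
Qed.

HB.instance Definition _ :=
  Lmodule_isNonAssocAlgebra.Build K free_alg fmul_bilinear.

Lemma free_eval_mul (B : naAlgType K) (f : Y -> B) :
  right_nil n B -> multiplicative (free_eval f).
Proof. by move=> hB x y; rewrite evalE. Qed.

Theorem free_alg_free :
  free_on (right_nil n) (fun y => class_of (TVar K y) : free_alg).
Proof.
split=> [x|C hC g].
  apply: free_eval_inj => B hB f.
  by rewrite (rpow_morph _ _ (free_eval_mul _ hB)) hB evalE.
split.
  exists (mklin (free_eval_linear g hC)); split; first exact: free_eval_mul.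
  by move=> y /=; rewrite evalE.
move=> phi psi phiM phiY psiM psiY x.
rewrite -[x]reprK -/(class_of _).
elim: (repr x)%qT => [y||s IHs t IHt|a s IHs|s IHs t IHt].
- by rewrite phiY psiY.
- by rewrite -/(0 : free_alg) !linear0.
- have -> : class_of (TAdd s t) = class_of s + class_of t by by_eval.
  by rewrite !linearD IHs IHt.
- have -> : class_of (TScale a s) = a *: class_of s by by_eval.
  by rewrite !linearZ IHs.
- have -> : class_of (TMul s t) = namul (class_of s) (class_of t) by by_eval.
  by rewrite phiM psiM IHs IHt.
Qed.

End FreeAlgebra.

(** * Leading terms *)

Section LeadingTerms.
Variables (K : fieldType) (A : naAlgType K) (pi : nat -> {linear A -> A}).
Hypothesis gr : grading pi.

Definition le_deg m x := forall j, (m < j)%N -> pi j x = 0.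

Lemma le_deg_submodule m : submodule (le_deg m).
Proof.
split=> [j _|a x y hx hy j mj]; first exact: linear0.
by rewrite linearP hx // hy // scaler0 addr0.
Qed.

Lemma le_deg_mul a b x y : le_deg a x -> le_deg b y ->
  le_deg (a + b) (namul x y) /\
  pi (a + b)%N (namul x y) = namul (pi a x) (pi b y).
Proof.
move=> hx hy; split=> [j abj|]; rewrite (grading_mul gr).
  apply: big1 => i _; have [ai|ia] := ltnP a i; first by rewrite hx ?namul0l.
  by rewrite hy ?namul0r //; lia.
have ab : (a < (a + b).+1)%N by lia.
rewrite (bigD1 (Ordinal ab)) //= addKn big1 ?addr0 // => i.
rewrite -val_eqE /= => ia; have [ai|ai] := ltnP a i; first by rewrite hx ?namul0l.
by rewrite hy ?namul0r //; lia.
Qed.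

Lemma le_degS m x : le_deg m.+1 x -> pi m.+1 x = 0 -> le_deg m x.
Proof. by move=> hx x0 j; rewrite leq_eqVlt => /predU1P[<-|/hx]. Qed.

Lemma le_deg_sum m x : le_deg m x -> x = \sum_(i < m.+1) pi i x.
Proof.
move=> hx; have [M hM] := grading_sum gr x.
rewrite {1}(hM (M + m.+1)%N) ?leq_addr //.
rewrite -!(big_mkord xpredT (fun i => pi i x)).
rewrite (@big_cat_nat _ _ _ m.+1) ?leq_addl //= [X in _ + X]big_nat.
by rewrite [X in _ + X]big1 ?addr0 // => i /andP[mi _]; apply: hx.
Qed.

Lemma le_deg0 x : le_deg 0 x -> x = 0.
Proof. by move/le_deg_sum; rewrite big_ord1 (grading_pos gr). Qed.

Lemma le_deg_exists x : exists m, le_deg m x.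
Proof.
have [M hM] := grading_sum gr x; exists M => j Mj.
have := hM j.+1 (leqW (ltnW Mj)).
by rewrite big_ord_recr -(hM j (ltnW Mj)) /= -[LHS]addr0 => /addrI <-.
Qed.

End LeadingTerms.

(** * Subalgebras of free algebras *)

Section SubalgebraOfFree.
Variables (K : fieldType) (n : nat) (n1 : (1 < n)%N).
Variables (F : naAlgType K) (X : Type) (iota : X -> F).
Hypothesis freeF : free_on (right_nil n) iota.
Variable pi : nat -> {linear F -> F}.
Hypothesis gr : grading pi.
Variable S : subalgebra F.

Definition lead_space m (x : F) :=
  exists s, [/\ s \in subalg_set S, le_deg pi m s & pi m s = x].

(** The span of the products of leading terms of smaller degrees, as the
    intersection of all subspaces that contain them. *)
Definition decomposable m (x : F) := forall U : F -> Prop, submodule U ->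
  (forall i j h h', (i + j)%N = m -> (0 < i)%N -> (0 < j)%N ->
     lead_space i h -> lead_space j h' -> U (namul h h')) ->
  U x.

Lemma subalg_mem_submodule : submodule (fun x => x \in subalg_set S).
Proof. exact: (subalg_submod S). Qed.

Lemma decomposable_submodule m : submodule (decomposable m).
Proof.
split=> [U hU _|a x y hx hy U hU hm]; first exact: (proj1 hU).
by apply: (proj2 hU); [apply: hx|apply: hy].
Qed.

(** [Y m] is a basis of the leading terms of degree [m] modulo the decomposable
    ones. *)
Variable Y : nat -> F -> Prop.
Hypothesis Y_lead : forall m y, Y m y -> lead_space m y.
Hypothesis Y_span : forall m (U : F -> Prop), submodule U ->
  (forall x, decomposable m x -> U x) -> (forall x, Y m x -> U x) ->
  forall x, lead_space m x -> U x.
Hypothesis Y_extend : forall m (W : lmodType K) (g : F -> W),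
  exists2 f : {linear F -> W},
    forall x, decomposable m x -> f x = 0 & forall y, Y m y -> f y = g y.

Definition generator := {m : nat & {y : F | Y m y}}.
Definition gen_deg (y : generator) := projT1 y.
Definition gen_lead (y : generator) : F := sval (projT2 y).

Lemma gen_leadP y : Y (gen_deg y) (gen_lead y).
Proof. exact: (svalP (projT2 y)). Qed.

(** Only [0] has degree [0], and a basis does not contain [0]. *)
Lemma gen_deg_gt0 y : (0 < gen_deg y)%N.
Proof.
rewrite lt0n; apply/eqP=> d0; have := gen_leadP y; rewrite d0 => Y0.
have [f _ fY] := Y_extend 0 (fun=> 1 : K^o).
have [s [_ _ y0]] := Y_lead Y0; have := fY _ Y0.
rewrite -y0 (grading_pos gr) linear0 => /eqP.
by rewrite eq_sym oner_eq0.
Qed.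

Variable lift : generator -> F.
Hypothesis lift_mem : forall y, lift y \in subalg_set S.
Hypothesis lift_deg : forall y, le_deg pi (gen_deg y) (lift y).
Hypothesis lift_lead : forall y, pi (gen_deg y) (lift y) = gen_lead y.

(** [G] is free on the union of the [Y m], graded by the degrees of the leading
    terms; [phi] maps generators to elements of [S], and [psi] to the leading
    terms of those. *)
Variables (G : naAlgType K) (gamma : generator -> G).
Hypothesis freeG : free_on (right_nil n) gamma.
Variable rho : nat -> {linear G -> G}.
Hypothesis grG : grading rho.
Hypothesis rho_gamma : forall y, rho (gen_deg y) (gamma y) = gamma y.
Variables phi psi : {linear G -> F}.
Hypotheses (phiM : multiplicative phi) (psiM : multiplicative psi).
Hypothesis phi_gamma : forall y, phi (gamma y) = lift y.
Hypothesis psi_gamma : forall y, psi (gamma y) = gen_lead y.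

Lemma phi_mem g : phi g \in subalg_set S.
Proof.
apply: (free_generated (P := fun g => phi g \in subalg_set S) freeG).
- split=> [|a x y hx hy]; first by rewrite linear0; apply: (proj1 subalg_mem_submodule).
  by rewrite linearP; apply: (proj2 subalg_mem_submodule).
- by move=> x y hx hy; rewrite phiM; apply: subalg_mul.
- by move=> y; rewrite phi_gamma.
Qed.

Lemma rho_generator i y :
  rho i (gamma y) = if i == gen_deg y then gamma y else 0.
Proof. by rewrite -{1}rho_gamma (grading_proj grG) rho_gamma. Qed.

(** On homogeneous elements, [psi] is the leading part of [phi]. *)
Lemma phi_lead g i : le_deg pi i (phi (rho i g)) /\
  pi i (phi (rho i g)) = psi (rho i g).
Proof.
move: i; pose P g := forall i, le_deg pi i (phi (rho i g)) /\
  pi i (phi (rho i g)) = psi (rho i g).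
apply: (free_generated (P := P) freeG).
- split=> [i|a x y hx hy i].
    by rewrite !linear0; split=> //; apply: (proj1 (le_deg_submodule pi i)).
  have [[dx lx] [dy ly]] := (hx i, hy i); rewrite !linearP lx ly; split=> //.
  exact: (proj2 (le_deg_submodule pi i)).
- move=> x y hx hy i; rewrite (grading_mul grG) !linear_sum /=.
  have h (k : 'I_i.+1) := le_deg_mul gr (hx k).1 (hy (i - k)%N).1.
  have ki (k : 'I_i.+1) : (k + (i - k))%N = i by rewrite subnKC // -ltnS.
  split.
    apply: submodule_sum; first exact: le_deg_submodule.
    by move=> k _; rewrite phiM -{1}(ki k); apply: (h k).1.
  apply: eq_bigr => k _.
  by rewrite phiM psiM -{1}(ki k) (h k).2 (hx k).2 (hy (i - k)%N).2.
- move=> y i; rewrite rho_generator; case: eqP => [->|_].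
    rewrite phi_gamma psi_gamma lift_lead; split=> //; exact: lift_deg.
  by rewrite !linear0; split=> //; apply: (proj1 (le_deg_submodule pi i)).
Qed.

Lemma psi_graded g i : pi i (psi g) = psi (rho i g).
Proof.
have [M hM] := grading_sum grG g.
have iN : (i < (M + i).+1)%N by lia.
rewrite {1}(hM (M + i).+1) ?leqW ?leq_addr // !linear_sum.
rewrite (bigD1 (Ordinal iN)) //= big1 ?addr0 => [|j].
  by rewrite -(phi_lead g i).2 (grading_proj gr) eqxx.
rewrite -val_eqE /= => ji.
by rewrite -(phi_lead g j).2 (grading_proj gr) eq_sym (negbTE ji).
Qed.

Lemma psi_lead_space g i : lead_space i (psi (rho i g)).
Proof.
by exists (phi (rho i g)); have [? ?] := phi_lead g i; split=> //; apply: phi_mem.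
Qed.

(** Up to sums of products, an element of degree [m] of [G] is determined by its
    image under [psi], since [Y m] is independent modulo decomposables. *)
Lemma modulo_products m : exists f : {linear F -> G},
  forall g, exists l : seq (G * G),
    rho m g - f (psi (rho m g)) = \sum_(v <- l) namul v.1 v.2.
Proof.
pose h (y : F) : G := if pselect (Y m y) is left Yy
  then gamma (existT _ m (exist _ y Yy)) else 0.
have [f f0 fY] := Y_extend m h; exists f.
pose P g := exists l : seq (G * G),
  rho m g - f (psi (rho m g)) = \sum_(v <- l) namul v.1 v.2.
apply: (free_generated (P := P) freeG).
- split; first by exists [::]; rewrite !linear0 addr0 big_nil.
  move=> a x y [l hl] [l' hl'].
  exists ([seq (a *: v.1, v.2) | v <- l] ++ l').
  rewrite big_cat big_map /= -hl' !linearP addrACA -scalerDr hl.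
  by rewrite scaler_sumr; congr (_ + _); apply: eq_bigr => v _; rewrite namulZl.
- move=> x y _ _.
  exists [seq (rho i x, rho (m - i)%N y) | i <- index_iota 0 m.+1].
  rewrite big_map big_mkord (grading_mul grG) !linear_sum /=.
  rewrite [X in _ + X]big1 ?addr0 // => i _.
  apply/eqP; rewrite oppr_eq0; apply/eqP.
  have [i0|i0] := posnP i.
    by rewrite i0 (grading_pos grG) namul0l !linear0.
  have [mi0|mi0] := posnP (m - i)%N.
    by rewrite mi0 (grading_pos grG) namul0r !linear0.
  rewrite psiM; apply: f0 => U hU; apply; try exact: psi_lead_space.
  + by rewrite subnKC // -ltnS.
  + by [].
  + by [].
- move=> y; exists [::]; rewrite big_nil rho_generator.
  case: eqP => [mE|_]; last by rewrite !linear0 addr0.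
  have Yy : Y m (gen_lead y) by rewrite mE; apply: gen_leadP.
  rewrite psi_gamma fY // /h; case: pselect => // {}Yy.
  apply/eqP; rewrite subr_eq0; apply/eqP; congr gamma.
  move: Yy; rewrite mE => Yy; case: y Yy {mE} => d [y Yy] Yy' /=; congr existT; congr exist.
  exact: Prop_irrelevance.
Qed.

(** By induction on the degree. An element of the kernel is a sum of products, by
    [modulo_products]. Its image is a relation among products of elements of the
    image of [psi], hence follows from the identity applied to elements
    [psi q.2]. As [psi] is injective in lower degrees, the tensor upstairs is the
    corresponding combination of the [q.2 (x) rpow n.-1 q.2], whose product is
    zero in [G]. *)
Lemma psi_injective m g : psi (rho m g) = 0 -> rho m g = 0.
Proof.
elim/ltn_ind: m g => m IH g g0.
have [f hf] := modulo_products m; have [l] := hf g.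
rewrite g0 linear0 subr0 => gE.
pose img x := exists g, x = psi g.
have [||||t tI ht] := @kernel_in_submodule K n n1 F pi gr (free_kernel n1 freeF)
    img [seq (psi v.1, psi v.2) | v <- l] m.
- exact: image_submodule.
- by move=> i _ [z ->]; exists (rho i z); rewrite psi_graded.
- by move=> _ /mapP[v _ ->]; exists v.1.
- rewrite big_map /= (_ : \sum_(v <- l) _ = psi (rho m g)).
    by rewrite g0 linear0.
  by rewrite gE linear_sum; apply: eq_bigr => v _; rewrite psiM.
have [t' tE] : exists t' : seq (K * G), t = [seq (q.1, psi q.2) | q <- t'].
  elim: t tI {ht} => [|[a x] t IHt] tI; first by exists [::].
  have [|t' ->] := IHt; first by move=> q qt; apply: tI; rewrite in_cons qt orbT.
  have [z xE] := tI _ (mem_head _ _).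
  by exists ((a, z) :: t'); rewrite /= -xE.
have transfer (h : {linear F -> K^o}) j : (0 < j)%N -> (j <= m)%N ->
    \sum_(v <- l) (h (psi (rho j v.1)) : K) *: rho (m - j)%N v.2 =
    \sum_(q <- t') (q.1 * (h (psi (rho j q.2)) : K)) *:
      rho (m - j)%N (rpow n.-1 q.2).
  move=> j0 jm; apply/eqP; rewrite -subr_eq0; apply/eqP.
  pose z := \sum_(v <- l) (h (psi (rho j v.1)) : K) *: v.2 -
    \sum_(q <- t') (q.1 * (h (psi (rho j q.2)) : K)) *: rpow n.-1 q.2.
  have zE : rho (m - j)%N z =
    \sum_(v <- l) (h (psi (rho j v.1)) : K) *: rho (m - j)%N v.2 -
    \sum_(q <- t') (q.1 * (h (psi (rho j q.2)) : K)) *: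
      rho (m - j)%N (rpow n.-1 q.2).
    rewrite linearB; congr (_ - _); rewrite linear_sum;
      by apply: eq_bigr => v _; rewrite linearZ.
  rewrite -zE; apply: IH; first by lia.
  rewrite zE linearB; apply/eqP; rewrite subr_eq0 !linear_sum; apply/eqP.
  have := ht h j jm; rewrite tE !big_map /= => E.
  transitivity (\sum_(v <- l) (h (pi j (psi v.1)) : K) *:
      pi (m - j)%N (psi v.2)).
    by apply: eq_bigr => v _; rewrite linearZ /= !psi_graded.
  rewrite E; apply: eq_bigr => q _.
  by rewrite linearZ /= -(rpow_morph _ _ psiM) !psi_graded.
have component j : (j <= m)%N ->
    \sum_(v <- l) namul (rho j v.1) (rho (m - j)%N v.2) =
    \sum_(q <- t') q.1 *: namul (rho j q.2) (rho (m - j)%N (rpow n.-1 q.2)).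
  move=> jm; have [j0|j0] := posnP j.
    rewrite !big1 // => v _; by rewrite j0 (grading_pos grG) namul0l ?scaler0.
  have [mj0|mj0] := posnP (m - j)%N.
    rewrite !big1 // => v _; by rewrite mj0 (grading_pos grG) namul0r ?scaler0.
  pose L := [seq (rho j v.1, rho (m - j)%N v.2) | v <- l] ++
    [seq (- q.1 *: rho j q.2, rho (m - j)%N (rpow n.-1 q.2)) | q <- t'].
  have := @tensor_eq0 _ _ _ L _ _ _ (namul_bilin G).
  rewrite !big_cat !big_map /= => E.
  apply/eqP; rewrite -subr_eq0; apply/eqP; rewrite -[RHS]E.
    rewrite -sumrN; congr (_ + _); apply: eq_bigr => q _.
    by rewrite namulZl scaleNr.
  move=> h; rewrite big_cat !big_map /=.
  (* Functionals on degree [j] of [G] come from functionals on [F] through an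
     inverse [chi] of [psi]. *)
  have [chi chiE] := generalized_inverse (psi \o rho j).
  have chi_rho x : rho j (chi (psi (rho j x))) = rho j x.
    apply/eqP; rewrite -subr_eq0 -linearB; apply/eqP; apply: IH; first by lia.
    by rewrite !linearB /=; apply/eqP; rewrite subr_eq0; apply/eqP; apply: chiE.
  have := transfer (h \o (rho j \o chi)) j j0 jm => /=.
  under eq_bigr do rewrite chi_rho.
  under [in RHS]eq_bigr do rewrite chi_rho.
  move=> ->; rewrite -[RHS](subrr (\sum_(q <- t') (q.1 * (h (rho j q.2) : K)) *:
     rho (m - j)%N (rpow n.-1 q.2))).
  congr (_ + _); rewrite -sumrN; apply: eq_bigr => q _.
  by rewrite linearZ /= -scaleNr; congr (_ *: _); apply: mulNr.
have nilG : right_nil n G by case: freeG.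
transitivity (rho m (\sum_(v <- l) namul v.1 v.2)).
  by rewrite -gE (grading_proj grG) eqxx.
transitivity (\sum_(q <- t') q.1 *: rho m (rpow n q.2)).
  rewrite linear_sum; under eq_bigr do rewrite (grading_mul grG).
  have nE (x : G) : rpow n x = namul x (rpow n.-1 x).
    by rewrite -rpowS ?prednK //; lia.
  under [in RHS]eq_bigr do rewrite nE (grading_mul grG) scaler_sumr.
  rewrite exchange_big [RHS]exchange_big /=; apply: eq_bigr => j _.
  by apply: component; rewrite -ltnS.
by apply: big1 => q _; rewrite nilG linear0 scaler0.
Qed.

(** The top component of an element of the kernel of [phi] is in the kernel of
    [psi]. *)
Lemma phi_injective g : phi g = 0 -> g = 0.
Proof.
have [m] := le_deg_exists grG g; elim: m => [|m IH] dg g0.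
  exact: (le_deg0 grG).
apply: IH => //; apply: le_degS => //; apply: psi_injective.
rewrite -[RHS](linear0 (pi m.+1)) -g0 {2}(le_deg_sum grG dg) !linear_sum.
rewrite big_ord_recr /= (phi_lead g m.+1).2 big1 ?add0r // => i _.
by apply: (phi_lead g i).1.
Qed.

(** By induction on the degree: the leading term of [s] is a combination of
    generators and products, and those of its factors lift by induction. *)
Lemma phi_surjective s : s \in subalg_set S -> exists g, phi g = s.
Proof.
have [m] := le_deg_exists gr s; elim/ltn_ind: m s => -[|m] IH s ds sS.
  by exists 0; rewrite linear0 (le_deg0 gr ds).
pose U x := exists2 g, le_deg pi m.+1 (phi g) & pi m.+1 (phi g) = x.
have hU : submodule U.
  split.
    by exists 0; rewrite !linear0 //; apply: (proj1 (le_deg_submodule pi _)).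
  move=> a _ _ [g dg <-] [h dh <-]; exists (a *: g + h); rewrite !linearP //.
  exact: (proj2 (le_deg_submodule pi _)).
have [g dg gs] : U (pi m.+1 s).
  apply: (Y_span hU (m := m.+1)); last by exists s.
    move=> x; apply=> // i j h h' ijm i0 j0 [u [uS du <-]] [v [vS dv <-]].
    have [|g gu] := IH i _ u du uS; first by lia.
    have [|g' gv] := IH j _ v dv vS; first by lia.
    exists (namul g g'); rewrite phiM gu gv -ijm;
      by have [] := le_deg_mul gr du dv.
  move=> y Yy; pose c : generator := existT _ m.+1 (exist _ y Yy).
  exists (gamma c); rewrite phi_gamma.
    exact: (@lift_deg c).
  exact: (lift_lead c).
have [||g' E] := IH m (ltnSn m) (s - phi g).
- apply: le_degS; first exact: (submoduleB (le_deg_submodule pi m.+1) ds dg).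
  by rewrite linearB gs subrr.
- exact: (submoduleB subalg_mem_submodule sS (phi_mem g)).
by exists (g' + g); rewrite linearD E subrK.
Qed.

(** [phi] is an isomorphism from [G] onto [S], which transports freeness. *)
Lemma subalgebra_free_on : exists eta : generator -> subalg_type S,
  free_on (right_nil n) eta.
Proof.
have [[nilF _] [nilG univG]] := (freeF, freeG).
pose cor g : subalg_type S := exist _ (phi g) (phi_mem g).
have cor_lin : linear cor by move=> a x y; apply: val_inj; rewrite /= linearP.
have cor_mul : multiplicative cor.
  by move=> x y; apply: val_inj; rewrite /= phiM.
have /choice[inv invP] : forall s : subalg_type S, exists g, cor g = s.
  move=> s; have [g gs] := phi_surjective (valP s); exists g.
  exact: val_inj.
have cor_inj x y : cor x = cor y -> x = y.
  move/(congr1 val) => /= xy; apply/eqP; rewrite -subr_eq0; apply/eqP.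
  by apply: phi_injective; rewrite linearB xy subrr.
have inv_lin : linear inv.
  by move=> a x y; apply: cor_inj; rewrite cor_lin !invP.
have inv_mul : multiplicative inv.
  by move=> x y; apply: cor_inj; rewrite cor_mul !invP.
exists (fun y => cor (gamma y)); split; first exact: right_nil_subalg.
move=> B hB f; have [[h [hM hg]] uniq] := univG B hB f; split.
  exists (h \o mklin inv_lin); split=> [x y|y] /=; first by rewrite inv_mul hM.
  by rewrite (cor_inj _ _ (invP _)).
move=> p q pM pf qM qf s; rewrite -(invP s).
by apply: (uniq (p \o mklin cor_lin) (q \o mklin cor_lin)) => //= x y;
  rewrite /= cor_mul ?pM ?qM.
Qed.

End SubalgebraOfFree.

(** For [n = 1] the identity reads [x = 0], so all algebras are zero. *)
Lemma right_nil1_free_in (K : fieldType) (A : naAlgType K) :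
  right_nil 1 A -> free_in (right_nil 1) A.
Proof.
move=> nilA; exists void, (@of_void A); split=> // B nilB f.
split; last first.
  move=> p q _ _ _ _ x.
  exact: etrans (nilB (p x)) (esym (nilB (q x))).
have lin0 : linear (fun _ : A => 0 : B) by move=> a x y; rewrite scaler0 addr0.
by exists (mklin lin0); split=> [x y|[]] /=; rewrite namul0l.
Qed.

Lemma right_nil_Nielsen_Schreier (K : fieldType) (n : nat) :
  [pchar K] =i pred0 -> (1 < n)%N -> Nielsen_Schreier (@right_nil K n).
Proof.
move=> K0 n1 F [X [iota freeF]] S.
have [pi gr _] := free_grading K0 freeF (w := fun=> 1%N) (fun=> isT).
have /choice[Y YP] := fun m => @relative_basis K F _ (lead_space pi S m)
  (decomposable_submodule pi S m).
have Y_lead m y : Y m y -> lead_space pi S m y by have [h _ _] := YP m; apply: h.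
have Y_span m U : submodule U -> (forall x, decomposable pi S m x -> U x) ->
    (forall x, Y m x -> U x) -> forall x, lead_space pi S m x -> U x.
  by have [_ h _] := YP m; apply: h.
have Y_ext m (W : lmodType K) (g : F -> W) : exists2 f : {linear F -> W},
    forall x, decomposable pi S m x -> f x = 0 & forall y, Y m y -> f y = g y.
  by have [_ _ h] := YP m; apply: h.
have /choice[lift liftP] : forall y : generator Y, exists s,
    [/\ s \in subalg_set S, le_deg pi (gen_deg y) s & pi (gen_deg y) s = gen_lead y].
  by move=> y; apply: Y_lead; apply: gen_leadP.
have freeG := free_alg_free K n (generator Y).
have [rho grG rho_gen] := free_grading K0 freeG
  (w := @gen_deg K F Y) (gen_deg_gt0 gr Y_lead Y_ext).
have [nilF _] := freeF.
have [_ /(_ F nilF) univG] := freeG.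
have [[phi [phiM phi_gen]] _] := univG lift.
have [[psi [psiM psi_gen]] _] := univG (@gen_lead K F Y).
have lift_mem y : lift y \in subalg_set S by case: (liftP y).
have lift_deg y : le_deg pi (gen_deg y) (lift y) by case: (liftP y).
have lift_lead y : pi (gen_deg y) (lift y) = gen_lead y by case: (liftP y).
have [eta freeS] : exists eta : generator Y -> subalg_type S,
    free_on (right_nil n) eta.
  exact: (@subalgebra_free_on K n n1 F X iota freeF pi gr S Y Y_span Y_ext lift
    lift_mem lift_deg lift_lead _ _ freeG rho grG rho_gen phi psi phiM psiM
    phi_gen psi_gen).
by exists (generator Y), eta.
Qed.

Local Close Scope ring_scope.
Unset Implicit Arguments.

Theorem theorem9p1 (K : fieldType) (charK0 : [pchar K]%R =i pred0)
  (n : nat) (n_gt0 : 0 < n) :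
  Nielsen_Schreier (@right_nil K n).
Proof.
have [n1|n1] := ltnP 1 n; first exact: right_nil_Nielsen_Schreier.
have -> : n = 1 by apply/eqP; rewrite eqn_leq n1.
move=> F [X [iota [nilF _]]] S.
by apply: right_nil1_free_in; apply: right_nil_subalg.
Qed.
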